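(* Let $k$ be a field and let $G={\rm Spec}\,A$ be a (linearly) semisimple affine $k$-group with invariant integral $w_G=\int_G dg$ and Fourier transform $F$. For all $a,b\in A$, $$\int_G a(g^{-1})\cdot b(g)\,dg=T^2(a,b)=T_2(F(a),F(b))=tr(F(a)\cdot F(b)).$$
   Context: An affine $k$-group $G={\rm Spec}\,A$ is called (linearly) semisimple if every linear representation of $G$ is completely reducible. $A^*={\rm Hom}_k(A,k)$ is a $k$-algebra with the product dual to the comultiplication of $A$. When $G$ is semisimple, $A^*=\prod_i A_i^*$ with $A_i^*$ finite-dimensional simple $k$-algebras; put $\tilde A:=\bigoplus_i A_i^*\subseteq A^*$. The invariant integral $w_G\in A^*$ is the unique $G$-invariant linear form on $A$ with $w_G(1)=1$; one writes $\int_G a(g)\,dg:=w_G(a)$. The map $a\mapsto a^*$ on $A$ is induced by $g\mapsto g^{-1}$, so $a^*(g)=a(g^{-1})$. The metric $T^2$ on $A$ is $T^2(a,a'):=w_G(a^*\cdot a')$. The Fourier transform is $F\colon A\to A^*$, $F(a)=w_G(a^*\cdot-)$, i.e. $F(a)(b)=w_G(a^*\cdot b)$; its image is $\tilde A$. On $\tilde A$, $tr(b)=\sum_i tr_{A_i^*}(b_i)$ where $tr_{A_i^*}(b_i)$ is the trace of the endomorphism $b'\mapsto b_ib'$ of $A_i^*$, and $T_2(b,b')=tr(bb')$. *)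

(* Defs.v *)
From HB Require Import structures.
From mathcomp Require Import all_boot all_algebra all_field.
From mathcomp Require Import boolp classical_sets cardinality fsbigop.

Set Implicit Arguments.
Unset Strict Implicit.
Unset Printing Implicit Defensive.

Import GRing.Theory.
Local Open Scope quotient_scope.
Local Open Scope ring_scope.

Notation is_bilinear f := (bilinear_for *:%R *:%R f).

(** Tensor product of two modules: formal sums of pairs (u, v), identified when
    every bilinear map to a module takes the same value on them. This is the
    quotient of the free module by the bilinearity relations; the universal
    property is given by [tlift_tens], [tlift_linear] and [tensor_ind]. *)
Section Tensor.
Variables (k : fieldType) (U V : lmodType k).
Implicit Types s t : seq (U * V).

Definition tsum (W : lmodType k) (f : U -> V -> W) (s : seq (U * V)) : W :=
  \sum_(p <- s) f p.1 p.2.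

Definition tens_eq s t : bool :=
  `[< forall (W : lmodType k) (f : U -> V -> W),
        is_bilinear f -> tsum f s = tsum f t >].

Fact tens_eq_is_equiv : equiv_class_of tens_eq.
Proof.
split=> [s|s t|t s r].
- exact/asboolP.
- by apply/asboolP/asboolP => e W f bf; rewrite e.
- by move=> /asboolP e1 /asboolP e2; apply/asboolP=> W f bf; rewrite e1 ?e2.
Qed.

Canonical tens_equiv := EquivRelPack tens_eq_is_equiv.
Definition tensor := {eq_quot tens_equiv}.
HB.instance Definition _ := Choice.on tensor.
HB.instance Definition _ := EqQuotient.on tensor.

(** Meaningful for bilinear [f] only. *)
Definition tlift (W : lmodType k) (f : U -> V -> W) (t : tensor) : W :=
  tsum f (repr t).

Lemma tliftE (W : lmodType k) (f : U -> V -> W) s :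
  is_bilinear f -> tlift f (\pi_tensor s) = tsum f s.
Proof.
move=> bf; rewrite /tlift.
have /eqquotP/asboolP e : \pi_tensor (repr (\pi_tensor s)) = \pi_tensor s.
  by rewrite reprK.
exact: e.
Qed.

Lemma tensor_eqP s t :
  (forall (W : lmodType k) (f : U -> V -> W), is_bilinear f ->
     tsum f s = tsum f t) -> \pi_tensor s = \pi_tensor t.
Proof. by move=> e; apply/eqquotP/asboolP. Qed.

Definition tens (u : U) (v : V) : tensor := \pi_tensor [:: (u, v)].

Definition tens_zero : tensor := \pi_tensor [::].
Definition tens_add (x y : tensor) : tensor := \pi_tensor (repr x ++ repr y).
Definition tens_scale (c : k) (x : tensor) : tensor :=
  \pi_tensor [seq (c *: p.1, p.2) | p <- repr x].

Lemma tlift0 (W : lmodType k) (f : U -> V -> W) :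
  is_bilinear f -> tlift f tens_zero = 0.
Proof. by move=> bf; rewrite tliftE // /tsum big_nil. Qed.

Lemma tliftD (W : lmodType k) (f : U -> V -> W) x y :
  is_bilinear f -> tlift f (tens_add x y) = tlift f x + tlift f y.
Proof. by move=> bf; rewrite tliftE // /tsum big_cat. Qed.

Lemma bilZl (W : lmodType k) (f : U -> V -> W) c u v :
  is_bilinear f -> f (c *: u) v = c *: f u v.
Proof. by case=> fl _; apply: (scalable_linear (fl v)). Qed.

Lemma tliftZ (W : lmodType k) (f : U -> V -> W) c x :
  is_bilinear f -> tlift f (tens_scale c x) = c *: tlift f x.
Proof.
move=> bf; rewrite tliftE // /tsum big_map /= /tlift /tsum scaler_sumr.
by apply: eq_bigr => p _; rewrite bilZl.
Qed.

Lemma tensor_ext (x y : tensor) :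
  (forall (W : lmodType k) (f : U -> V -> W), is_bilinear f ->
     tlift f x = tlift f y) -> x = y.
Proof.
move=> e; rewrite -[x]reprK -[y]reprK; apply: tensor_eqP => W f bf.
exact: e.
Qed.

Fact tens_addA : associative tens_add.
Proof. by move=> x y z; apply: tensor_ext => W f bf; rewrite !tliftD ?addrA. Qed.
Fact tens_addC : commutative tens_add.
Proof. by move=> x y; apply: tensor_ext => W f bf; rewrite !tliftD // addrC. Qed.
Fact tens_add0 : left_id tens_zero tens_add.
Proof. by move=> x; apply: tensor_ext => W f bf; rewrite tliftD // tlift0 ?add0r. Qed.
Fact tens_addN : left_inverse tens_zero (tens_scale (-1)) tens_add.
Proof.
move=> x; apply: tensor_ext => W f bf.
by rewrite tliftD // tliftZ // tlift0 // scaleN1r addNr.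
Qed.

HB.instance Definition _ := GRing.isZmodule.Build tensor
  tens_addA tens_addC tens_add0 tens_addN.

Fact tens_scaleA a b x : tens_scale a (tens_scale b x) = tens_scale (a * b) x.
Proof. by apply: tensor_ext => W f bf; rewrite !tliftZ // scalerA. Qed.
Fact tens_scale1 : left_id 1 tens_scale.
Proof. by move=> x; apply: tensor_ext => W f bf; rewrite !tliftZ // scale1r. Qed.
Fact tens_scaleDr : right_distributive tens_scale +%R.
Proof.
move=> a x y; apply: tensor_ext => W f bf.
by rewrite !(tliftD, tliftZ) // scalerDr.
Qed.
Fact tens_scaleDl x : {morph tens_scale^~ x : a b / a + b}.
Proof.
move=> a b; apply: tensor_ext => W f bf.
by rewrite !(tliftD, tliftZ) // scalerDl.
Qed.

HB.instance Definition _ := GRing.Zmodule_isLmodule.Build k tensor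
  tens_scaleA tens_scale1 tens_scaleDr tens_scaleDl.

Lemma tlift_linear (W : lmodType k) (f : U -> V -> W) :
  is_bilinear f -> linear (tlift f).
Proof. by move=> bf c x y; rewrite tliftD // tliftZ. Qed.

Lemma tlift_tens (W : lmodType k) (f : U -> V -> W) u v :
  is_bilinear f -> tlift f (tens u v) = f u v.
Proof. by move=> bf; rewrite tliftE // /tsum big_seq1. Qed.

Lemma tens_bilinear : is_bilinear tens.
Proof.
split=> [v c u u'|u c v v']; apply: tensor_ext => W f bf.
  by rewrite (tlift_linear bf) !tlift_tens // (bf.1 v c u u').
by rewrite (tlift_linear bf) !tlift_tens // (bf.2 u c v v').
Qed.

Lemma tensor_sum (x : tensor) : x = \sum_(p <- repr x) tens p.1 p.2.
Proof.
apply: tensor_ext => W f bf; rewrite {1}/tlift /tsum.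
elim: (repr x) => [|p s IH]; first by rewrite !big_nil [RHS](tlift0 bf).
by rewrite !big_cons [RHS](tliftD _ _ bf) -IH tlift_tens.
Qed.

Lemma tensor_ind (P : tensor -> Prop) :
  P 0 -> (forall u v, P (tens u v)) -> (forall x y, P x -> P y -> P (x + y)) ->
  forall x, P x.
Proof.
move=> P0 Pt PD x; rewrite [x]tensor_sum.
by elim: (repr x) => [|p s IH]; rewrite ?big_nil // big_cons; apply: PD.
Qed.

Lemma linear_tensor_eq (W : lmodType k) (f g : tensor -> W) :
  linear f -> linear g -> (forall u v, f (tens u v) = g (tens u v)) -> f =1 g.
Proof.
move=> lf lg e; apply: tensor_ind => // [|x y ex ey].
  by rewrite -(subrr 0) (zmod_morphism_linear lf) (zmod_morphism_linear lg) !subrr.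
by have := lf 1 x y; have := lg 1 x y; rewrite !scale1r ex ey => -> ->.
Qed.

End Tensor.

Lemma tlift_post (k : fieldType) (U V W W' : lmodType k) (f : U -> V -> W)
    (g : W -> W') t : linear g -> g (tlift f t) = tlift (fun u v => g (f u v)) t.
Proof.
move=> lg; rewrite /tlift /tsum; apply: (big_morph g).
  by move=> x y; have := lg 1 x y; rewrite !scale1r.
by rewrite -(subrr 0) (zmod_morphism_linear lg) subrr.
Qed.

Lemma eq_tlift (k : fieldType) (U V W : lmodType k) (f g : U -> V -> W) t :
  (forall u v, f u v = g u v) -> tlift f t = tlift g t.
Proof. by move=> e; apply: eq_bigr => p _. Qed.

Notation "u ⊗ v" := (tens u v) (at level 40, left associativity) : ring_scope.

Definition tmap (k : fieldType) (U V U' V' : lmodType k)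
    (f : U -> U') (g : V -> V') : tensor U V -> tensor U' V' :=
  tlift (fun u v => f u ⊗ g v).

Definition tassoc (k : fieldType) (U V W : lmodType k) :
    tensor (tensor U V) W -> tensor U (tensor V W) :=
  tlift (fun t w => tlift (fun u v => u ⊗ (v ⊗ w)) t).

Definition tmul (k : fieldType) (A B : algType k) (s t : tensor A B) :
    tensor A B :=
  tlift (fun a b => tlift (fun a' b' => (a * a') ⊗ (b * b')) t) s.

(** Group structure on [Spec A], i.e. commutative Hopf algebra structure on [A]. *)
Record affine_group (k : fieldType) (A : comAlgType k) := AffineGroup {
  comul : {linear A -> tensor A A};
  counit : {lrmorphism A -> k^o};
  antipode : {lrmorphism A -> A};
  comul1 : comul 1 = 1 ⊗ 1;
  comulM : forall a b, comul (a * b) = tmul (comul a) (comul b);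
  comulA : forall a, tassoc (tmap comul id (comul a)) = tmap id comul (comul a);
  counitl : forall a, tlift (fun x y => counit x *: y) (comul a) = a;
  counitr : forall a, tlift (fun x y => counit y *: x) (comul a) = a;
  antipodel : forall a,
    tlift (fun x y => antipode x * y) (comul a) = (counit a : k)%:A;
  antipoder : forall a,
    tlift (fun x y => x * antipode y) (comul a) = (counit a : k)%:A
}.

Section Representations.
Variables (k : fieldType) (A : comAlgType k) (G : affine_group A).

(** Linear action of [G] on a possibly infinite-dimensional space: if
    [coact v] is the sum of the [v_j ⊗ a_j] then [g v] is the sum of the
    [a_j(g) v_j]. *)
Record representation (V : lmodType k) := Representation {
  coact : {linear V -> tensor V A};
  coactA : forall v,
    tassoc (tmap coact id (coact v)) = tmap id (comul G) (coact v);
  coact1 : forall v, tlift (fun x a => counit G a *: x) (coact v) = v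
}.

Definition subrepresentation V (rho : representation V) (W : {pred V}) : Prop :=
  submod_closed W /\
  forall v, v \in W -> exists s : seq (V * A),
    (forall p, p \in s -> p.1 \in W) /\ coact rho v = \sum_(p <- s) p.1 ⊗ p.2.

Definition completely_reducible V (rho : representation V) : Prop :=
  forall W, subrepresentation rho W ->
  exists W', [/\ subrepresentation rho W',
    forall v, v \in W -> v \in W' -> v = 0 &
    forall v, exists w w', [/\ w \in W, w' \in W' & v = w + w']].

Definition semisimple : Prop :=
  forall (V : lmodType k) (rho : representation V), completely_reducible rho.

End Representations.

(** The linear dual of [A]; it depends on [G] through its product. *)
Definition dual (k : fieldType) (A : comAlgType k) (G : affine_group A) : Type :=
  {linear A -> k^o}.

Section DualAlgebra.
Variables (k : fieldType) (A : comAlgType k) (G : affine_group A).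
Implicit Types f g h : dual G.

HB.instance Definition _ := gen_eqMixin (dual G).
HB.instance Definition _ := gen_choiceMixin (dual G).

Definition dual_fun f : A -> k := (f : {linear A -> k^o}).
Local Coercion dual_fun : dual >-> Funclass.

Definition mk_dual (f : A -> k^o) (lf : linear f) : dual G :=
  HB.pack_for {linear A -> k^o} f
    (GRing.isSemilinear.Build k A k^o *:%R f (GRing.semilinear_linear lf)).

Lemma dualP f g : (forall a, f a = g a) -> f = g.
Proof.
rewrite /dual_fun; case: f => f [[f1] [f2]]; case: g => g [[g1] [g2]] /= e.
have {}e : f = g by apply/funext.
by subst g; rewrite (Prop_irrelevance f1 g1) (Prop_irrelevance f2 g2).
Qed.

Lemma dual_linear f : linear (dual_fun f : A -> k^o).
Proof. exact: linearP. Qed.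

Fact dual_zero_linear : linear (fun _ : A => 0 : k^o).
Proof. by move=> c x y; rewrite scaler0 addr0. Qed.
Fact dual_add_linear f g : linear (fun a => f a + g a : k^o).
Proof. by move=> c x y; rewrite !dual_linear scalerDr addrACA. Qed.
Fact dual_opp_linear f : linear (fun a => - f a : k^o).
Proof. by move=> c x y; rewrite dual_linear opprD scalerN. Qed.
Fact dual_scale_linear d f : linear (fun a => d * f a : k^o).
Proof. by move=> c x y; rewrite dual_linear mulrDr [X in X + _]mulrCA. Qed.

Definition dual_zero := mk_dual dual_zero_linear.
Definition dual_add f g := mk_dual (dual_add_linear f g).
Definition dual_opp f := mk_dual (dual_opp_linear f).
Definition dual_scale d f := mk_dual (dual_scale_linear d f).

Fact dual_addA : associative dual_add.
Proof. by move=> f g h; apply: dualP => a; apply: addrA. Qed.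
Fact dual_addC : commutative dual_add.
Proof. by move=> f g; apply: dualP => a; apply: addrC. Qed.
Fact dual_add0 : left_id dual_zero dual_add.
Proof. by move=> f; apply: dualP => a; apply: add0r. Qed.
Fact dual_addN : left_inverse dual_zero dual_opp dual_add.
Proof. by move=> f; apply: dualP => a; apply: addNr. Qed.

HB.instance Definition _ := GRing.isZmodule.Build (dual G)
  dual_addA dual_addC dual_add0 dual_addN.

Lemma prod_bilinear f g : is_bilinear (fun x y => f x * g y : k^o).
Proof.
split=> [v c x y|v c x y] /=.
  by rewrite dual_linear mulrDl -mulrA.
by rewrite dual_linear mulrDr [X in X + _]mulrCA.
Qed.

(** Convolution: the product dual to the comultiplication. *)
Definition dual_mul_fun f g (a : A) : k^o :=
  tlift (fun x y => f x * g y : k^o) (comul G a).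

Fact dual_mul_linear f g : linear (dual_mul_fun f g).
Proof.
move=> c x y; rewrite /dual_mul_fun linearP.
exact: (tlift_linear (prod_bilinear f g)).
Qed.
Fact dual_one_linear : linear (fun a => counit G a : k^o).
Proof. exact: linearP. Qed.

Definition dual_mul f g := mk_dual (dual_mul_linear f g).
Definition dual_one := mk_dual dual_one_linear.

Fact dual_mulA : associative dual_mul.
Proof.
move=> f g h; apply: dualP => a.
pose m (u v : dual G) := fun x y => u x * v y : k^o.
pose Phi := tlift (fun u t => f u * tlift (m g h) t : k^o)
  : tensor A (tensor A A) -> k^o.
have mb u v : is_bilinear (m u v) by apply: prod_bilinear.
have mE u v z : dual_mul u v z = tlift (m u v) (comul G z) by [].
have bPhi : is_bilinear (fun u t => f u * tlift (m g h) t : k^o).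
  split=> [v c x y|v c x y] /=; first by rewrite dual_linear mulrDl -mulrA.
  by rewrite (tlift_linear (mb g h)) mulrDr [X in X + _]mulrCA.
have lPhi : linear Phi by apply: tlift_linear.
have b1 (w : A) : is_bilinear (fun u v : A => u ⊗ (v ⊗ w)).
  by split=> [v c x y|v c x y] /=; rewrite ?(tens_bilinear _ _).1
    ?(tens_bilinear _ _).2 ?(tens_bilinear _ _).1 ?(tens_bilinear _ _).2.
have b2 : is_bilinear (fun (t : tensor A A) (w : A) =>
            tlift (fun u v : A => u ⊗ (v ⊗ w)) t).
  split=> [w c x y|x c v w] /=; first exact: tlift_linear.
  elim/tensor_ind: x => [|x y|x y ex ey].
  - by rewrite ![tlift _ 0](tlift0 (b1 _)) scaler0 addr0.
  - by rewrite !tlift_tens // !(tens_bilinear _ _).2.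
  rewrite ![tlift _ (x + y)](tliftD _ _ (b1 _)) ex ey scalerDr.
  by rewrite addrACA.
have bD : is_bilinear (fun u v : A => comul G u ⊗ v).
  by split=> [v c x y|v c x y] /=; rewrite ?linearP ?(tens_bilinear _ _).1
    ?(tens_bilinear _ _).2.
transitivity (Phi (tmap id (comul G) (comul G a))).
  rewrite mE /tmap tlift_post //; apply: (@eq_tlift _ _ _ k^o) => x y.
  by rewrite /Phi tlift_tens // /m mE.
rewrite mE -comulA /tmap /tassoc [X in Phi X](tlift_post _ _ (tlift_linear b2)).
rewrite (tlift_post _ _ lPhi); apply: (@eq_tlift _ _ _ k^o) => x y.
rewrite tlift_tens // (tlift_post _ _ lPhi) [in RHS]/m mE.
transitivity (tlift (fun u v => m f g u v * h y : k^o) (comul G x)).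
  by apply: (@eq_tlift _ _ _ k^o) => u v; rewrite /Phi !tlift_tens // /m mulrA.
rewrite -(@tlift_post _ _ _ _ _ _ (fun z : k^o => z * h y : k^o)) //.
by move=> c z z'; rewrite mulrDl -mulrA.
Qed.

Fact dual_mul1f : left_id dual_one dual_mul.
Proof.
move=> f; apply: dualP => a; rewrite -[in RHS](counitl G a).
rewrite [RHS]tlift_post; last exact: dual_linear.
by apply: (@eq_tlift _ _ _ k^o) => x y; rewrite /= [RHS](scalable_linear (dual_linear f)).
Qed.
Fact dual_mulf1 : right_id dual_one dual_mul.
Proof.
move=> f; apply: dualP => a; rewrite -[in RHS](counitr G a).
rewrite [RHS]tlift_post; last exact: dual_linear.
apply: (@eq_tlift _ _ _ k^o) => x y; rewrite /= [RHS](scalable_linear (dual_linear f)).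
exact: mulrC.
Qed.
Fact dual_mulDl : left_distributive dual_mul dual_add.
Proof.
move=> f g h; apply: dualP => a; rewrite /dual_fun /= /dual_mul_fun -big_split.
by apply: eq_bigr => p _; rewrite mulrDl.
Qed.
Fact dual_mulDr : right_distributive dual_mul dual_add.
Proof.
move=> f g h; apply: dualP => a; rewrite /dual_fun /= /dual_mul_fun -big_split.
by apply: eq_bigr => p _; rewrite mulrDr.
Qed.
Fact dual_one_neq0 : dual_one != 0.
Proof.
apply/eqP => /(congr1 (fun f => dual_fun f 1)); rewrite /dual_fun /= rmorph1.
by move/eqP; rewrite oner_eq0.
Qed.

HB.instance Definition _ := GRing.Zmodule_isNzRing.Build (dual G)
  dual_mulA dual_mul1f dual_mulf1 dual_mulDl dual_mulDr dual_one_neq0.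

Fact dual_scaleA a b f : dual_scale a (dual_scale b f) = dual_scale (a * b) f.
Proof. by apply: dualP => x; apply: mulrA. Qed.
Fact dual_scale1 : left_id 1 dual_scale.
Proof. by move=> f; apply: dualP => x; apply: mul1r. Qed.
Fact dual_scaleDr : right_distributive dual_scale +%R.
Proof. by move=> a f g; apply: dualP => x; apply: mulrDr. Qed.
Fact dual_scaleDl f : {morph dual_scale^~ f : a b / a + b}.
Proof. by move=> a b; apply: dualP => x; apply: mulrDl. Qed.

HB.instance Definition _ := GRing.Zmodule_isLmodule.Build k (dual G)
  dual_scaleA dual_scale1 dual_scaleDr dual_scaleDl.

Fact dual_scaleAl c f g : c *: (f * g) = (c *: f) * g.
Proof.
apply: dualP => a; transitivity (c *: dual_mul_fun f g a) => //.
rewrite /dual_mul_fun /tlift /tsum scaler_sumr.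
by apply: eq_bigr => p _; apply: mulrA.
Qed.
Fact dual_scaleAr c f g : c *: (f * g) = f * (c *: g).
Proof.
apply: dualP => a; transitivity (c *: dual_mul_fun f g a) => //.
rewrite /dual_mul_fun /tlift /tsum scaler_sumr.
by apply: eq_bigr => p _; apply: mulrCA.
Qed.

HB.instance Definition _ := GRing.Lmodule_isLalgebra.Build k (dual G) dual_scaleAl.
HB.instance Definition _ := GRing.Lalgebra_isAlgebra.Build k (dual G) dual_scaleAr.

End DualAlgebra.

Coercion dual_fun : dual >-> Funclass.

Section Fourier.
Variables (k : fieldType) (A : comAlgType k) (G : affine_group A).
Implicit Types (a b : A) (w : dual G).

(** [w] is a [G]-invariant linear form with [w 1 = 1]; invariance says that the
    function of [g'] given by the integral of [a(g' g)] over [g] is constant. *)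
Definition invariant_integral w : Prop :=
  (forall a, tlift (fun x y => w y *: x) (comul G a) = w a *: 1) /\ w 1 = 1.

Definition T_up w a b : k := w (antipode G a * b).

Fact fourier_linear w a : linear (fun b => w (antipode G a * b) : k^o).
Proof. by move=> c x y; rewrite mulrDr -scalerAr dual_linear. Qed.

Definition fourier w a : dual G := mk_dual G (fourier_linear w a).

End Fourier.

Definition simple_algebra (k : fieldType) (B : falgType k) : Prop :=
  forall J : {vspace B},
    (fullv * J <= J)%VS -> (J * fullv <= J)%VS -> J = 0%VS \/ J = fullv.

(** An identification of the dual algebra with the product of a family of
    finite-dimensional simple algebras. The factors are determined up to
    reindexing: they are the minimal two-sided ideals of the dual algebra. *)
Record simple_decomposition (k : fieldType) (A : comAlgType k)
    (G : affine_group A) := SimpleDecomposition {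
  factor_index : choiceType;
  factor : factor_index -> falgType k;
  factor_proj : forall i, {lrmorphism dual G -> factor i};
  factor_simple : forall i, simple_algebra (factor i);
  factor_proj_bij : bijective (fun (f : dual G) i => factor_proj i f)
}.

Arguments factor_proj {k A G} s i.

Section Trace.
Variables (k : fieldType) (A : comAlgType k) (G : affine_group A).
Variable D : simple_decomposition G.
Implicit Types f g : dual G.

(** The direct sum of the factors inside the dual algebra. *)
Definition dual_sum : set (dual G) :=
  [set f | finite_set [set i | factor_proj D i f != 0]].

(** Trace of the endomorphism [x |-> b * x], computed in a basis. *)
Definition alg_trace (B : falgType k) (b : B) : k :=
  \sum_(i < \dim {:B}) coord (vbasis {:B}) i (b * (vbasis {:B})`_i).

(** Only meaningful on [dual_sum], where the sum is finite. *)
Definition tr f : k :=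
  \sum_(i \in [set: factor_index D]) alg_trace (factor_proj D i f).

Definition T_down f g : k := tr (f * g).

End Trace.

(* Main.v *)
From HB Require Import structures.
Require Import Defs.
From mathcomp Require Import all_boot all_algebra all_field.
From mathcomp Require Import finmap.
From mathcomp Require Import boolp classical_sets cardinality fsbigop.

Import GRing.Theory.
Local Open Scope ring_scope.

Set Implicit Arguments.
Unset Strict Implicit.
Unset Printing Implicit Defensive.

(** Write [S] for the antipode, [c_1 ⊗ c_2] for the coproduct of [c] (with an
    implicit sum) and [phi_c] for the form [b |-> w (c b)], so that the Fourier
    transform of [a] is [phi_(S a)]. The proof computes traces in the dual
    algebra by writing left multiplication by [phi_c] as an explicit operator
    of finite rank.

    Invariance of [w] and the antipode axioms give, for each form [x],
      [x phi_d = x(S d_1) phi_(d_2)]   and   [phi_c x = x(S c_2) phi_(c_1)]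
    ([mul_density], [density_mul]). The second formula requires [w] to be
    invariant on both sides, that is, to be central in the dual algebra. As the
    dual algebra acts on [w] through evaluation at 1, the simple factor of the
    dual algebra in which [w] has a nonzero component must have dimension 1, and
    [w] is a multiple of the central idempotent of that factor
    ([integral_central]).

    The second formula shows that [phi_c] has finite rank as a left
    multiplication, so it has finitely many nonzero components
    ([finite_rank_dual_sum]), and that its trace is
      [phi_(c_1)(S c_2) = w (c_1 S(c_2)) = eps(c)],
    where [eps] is the counit ([finite_rank_tr], [tr_density]). By the first
    formula [phi_c phi_d] is the density of [w (c S(d_1)) d_2], which has trace
    [w (c S(d))]. For [c = S a] and [d = S b] this is [w (S(a) b)], because [S]
    is an involution on a commutative Hopf algebra ([antipodeK]). *)

(** * Convolution of linear endomorphisms and the antipode *)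

Section Convolution.
Variables (k : fieldType) (A : comAlgType k) (G : affine_group A).

(** Coassociativity in the form in which it is used: a trilinear map gives a
    linear map on the triple tensor product, and so takes the same value on the
    two iterated coproducts of [a]. *)
Lemma comul_coassoc (W : lmodType k) (T : A -> A -> A -> W) a :
  (forall u v, linear (T u v)) ->
  (forall u z, linear (fun v => T u v z)) ->
  (forall v z, linear (fun u => T u v z)) ->
  tlift (fun x z => tlift (fun u v => T u v z) (comul G x)) (comul G a) =
  tlift (fun u y => tlift (T u) (comul G y)) (comul G a).
Proof.
move=> T3 T2 T1.
have bT u : is_bilinear (T u) by split=> [z|v]; [apply: T2 | apply: T3].
have bPhi : is_bilinear (fun u t => tlift (T u) t).
  split=> [t c x y|u] /=; last exact: tlift_linear.
  rewrite /tlift /tsum scaler_sumr -big_split /=.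
  by apply: eq_bigr => p _; rewrite (T1 p.1 p.2).
pose Phi := tlift (fun u t => tlift (T u) t) : tensor A (tensor A A) -> W.
have lPhi : linear Phi by apply: tlift_linear.
have bz (z : A) : is_bilinear (fun u v : A => u ⊗ (v ⊗ z)).
  split=> [v c x y|v c x y]; first by rewrite (tens_bilinear _ _).1.
  by rewrite (tens_bilinear _ _).1 (tens_bilinear _ _).2.
have bassoc : is_bilinear (fun (t : tensor A A) (z : A) =>
                             tlift (fun u v : A => u ⊗ (v ⊗ z)) t).
  split=> [z|t c x y] /=; first exact: tlift_linear.
  rewrite /tlift /tsum scaler_sumr -big_split /=.
  by apply: eq_bigr => p _; rewrite !(tens_bilinear _ _).2.
transitivity (Phi (tassoc (tmap (comul G) id (comul G a)))).
  rewrite /tmap /tassoc [X in Phi X](tlift_post _ _ (tlift_linear bassoc)).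
  rewrite (tlift_post _ _ lPhi); apply: eq_tlift => x z.
  rewrite tlift_tens // (tlift_post _ _ lPhi); apply: eq_tlift => u v.
  by rewrite /Phi !tlift_tens.
rewrite comulA /tmap (tlift_post _ _ lPhi); apply: eq_tlift => u y.
by rewrite /Phi tlift_tens.
Qed.

Definition conv (f g : A -> A) (a : A) : A :=
  tlift (fun x y => f x * g y) (comul G a).

Lemma eq_conv f f' g g' : f =1 f' -> g =1 g' -> conv f g =1 conv f' g'.
Proof. by move=> ef eg a; apply: eq_tlift => x y; rewrite ef eg. Qed.

Lemma convA f g h : linear f -> linear g -> linear h ->
  conv (conv f g) h =1 conv f (conv g h).
Proof.
move=> lf lg lh a; rewrite /conv.
transitivity (tlift (fun x z => tlift (fun u v => f u * g v * h z) (comul G x))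
                (comul G a)).
  apply: eq_tlift => x z; rewrite -(@tlift_post _ _ _ _ _ _ (fun t => t * h z)) //.
  by move=> c s t /=; rewrite mulrDl scalerAl.
rewrite comul_coassoc => [|u v c x y|u z c x y|v z c x y] /=.
- apply: eq_tlift => u y.
  rewrite (@tlift_post _ _ _ _ _ _ (fun t => f u * t)); last first.
    by move=> c s t /=; rewrite mulrDr scalerAr.
  by apply: eq_tlift => v z; rewrite mulrA.
- by rewrite lh mulrDr scalerAr.
- by rewrite lg mulrDr mulrDl -scalerAr -scalerAl.
- by rewrite lf !mulrDl !scalerAl.
Qed.

Lemma linear_id : linear (id : A -> A). Proof. by []. Qed.

Lemma antipode_linear : linear (antipode G). Proof. exact: linearP. Qed.

(** The antipode is the inverse of the identity for convolution, so a linear map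
    can be recovered from its convolution with the identity. The two versions
    below are what turns invariance of an integral into the formulas
    [mul_density] and [density_mul]. *)
Lemma conv_antipodeK f : linear f -> conv (conv f id) (antipode G) =1 f.
Proof.
move=> lf a; rewrite (convA lf linear_id antipode_linear).
rewrite (eq_conv (fun _ => erefl) (antipoder G)) -[in RHS](counitr G a).
rewrite (tlift_post _ _ lf); apply: eq_tlift => x y.
by rewrite -scalerAr mulr1 (scalable_linear lf).
Qed.

Lemma antipode_convK f : linear f -> conv (antipode G) (conv id f) =1 f.
Proof.
move=> lf a; rewrite -(convA antipode_linear linear_id lf).
rewrite (eq_conv (antipodel G) (fun _ => erefl)) -[in RHS](counitl G a).
rewrite (tlift_post _ _ lf); apply: eq_tlift => x y.
by rewrite -scalerAl mul1r (scalable_linear lf).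
Qed.

(** The antipode is multiplicative because [A] is commutative, so applying it to
    its own defining equation shows that its square is a left convolution
    inverse of the antipode. So is the identity. *)
Lemma antipodeK : involutive (antipode G).
Proof.
move=> a; pose SS := antipode G \o antipode G.
have lSS : linear SS by move=> c x y; rewrite /SS /= !linearP.
have SSS : conv SS (antipode G) =1 fun x => (counit G x : k)%:A.
  move=> x; transitivity (antipode G (conv (antipode G) id x)).
    rewrite /conv (tlift_post _ _ antipode_linear).
    by apply: eq_tlift => y z; rewrite rmorphM.
  by rewrite [conv _ _ x]antipodel linearZ /= rmorph1.
transitivity (conv SS (conv (antipode G) id) a).
  rewrite -[LHS]/(SS a) -[in LHS](counitr G a) (tlift_post _ _ lSS).
  apply: eq_tlift => x y; rewrite [conv _ _ y]antipodel.
  by rewrite -scalerAr mulr1 (scalable_linear lSS).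
rewrite -(convA lSS antipode_linear linear_id) -[RHS](counitl G a).
by apply: eq_tlift => x y; rewrite SSS -scalerAl mul1r.
Qed.

End Convolution.

(** * Products of forms with densities of an invariant integral *)

Section Density.
Variables (k : fieldType) (A : comAlgType k) (G : affine_group A) (w : dual G).

Fact density_linear (c : A) : linear (fun b => w (c * b) : k^o).
Proof. by move=> d x y; rewrite mulrDr -scalerAr dual_linear. Qed.

(** The form obtained from [w] by multiplying the argument by [c]: the Fourier
    transform without the antipode, which makes its products with other forms
    easier to state. *)
Definition density c : dual G := mk_dual G (density_linear c).

Lemma linear_density : linear density.
Proof.
move=> d x y; apply: dualP => b.
by rewrite /dual_fun /= mulrDl -scalerAl dual_linear.
Qed.

Lemma tlift_comulM (W : lmodType k) (f : A -> A -> W) c b : is_bilinear f ->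
  tlift f (comul G (c * b)) =
  tlift (fun u v => tlift (fun y z => f (u * y) (v * z)) (comul G b))
    (comul G c).
Proof.
move=> bf; have lf := tlift_linear bf; rewrite comulM /tmul (tlift_post _ _ lf).
apply: eq_tlift => u v; rewrite (tlift_post _ _ lf).
by apply: eq_tlift => y z; rewrite tlift_tens.
Qed.

Hypothesis w_int : invariant_integral w.

(** Write [P d] for the sum of the [w (d b_2) b_1]. Invariance at [d b] says
    that the sum of the [d_1 P(d_2)] is the scalar [w (d b)]; the antipode then
    isolates [P d] as the sum of the [w (d_2 b) S(d_1)], and the left-hand side
    at [b] is [x (P d)]. *)
Lemma mul_density (x : dual G) d :
  x * density d = density (tlift (fun u v => x (antipode G u) *: v) (comul G d)).
Proof.
apply: dualP => b.
have bw : is_bilinear (fun x y : A => w y *: x).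
  split=> [v c y z|u c y z] /=; first by rewrite scalerDr scalerA mulrC -scalerA.
  by rewrite dual_linear scalerDl -scalerA.
pose P d' : A := tlift (fun y z => w (d' * z) *: y) (comul G b).
have lP : linear P.
  move=> c y z; rewrite /P /tlift /tsum scaler_sumr -big_split /=.
  by apply: eq_bigr => p _; rewrite mulrDl -scalerAl dual_linear scalerDl -scalerA.
have idP : conv G id P =1 fun d' => w (d' * b) *: 1.
  move=> d'; rewrite -w_int.1 (tlift_comulM _ _ bw); apply: eq_tlift => u v.
  rewrite /P /tlift /tsum mulr_sumr; apply: eq_bigr => p _.
  by rewrite scalerAr.
transitivity (x (P d)).
  rewrite /P [RHS](tlift_post _ _ (dual_linear x)).
  apply: (@eq_tlift _ _ _ k^o) => y z.
  by rewrite [RHS](scalable_linear (dual_linear x)) mulrC.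
rewrite -(antipode_convK G lP) (eq_conv _ (fun _ => erefl) idP) /conv.
rewrite [LHS](tlift_post _ _ (dual_linear x)).
rewrite [RHS](@tlift_post _ _ _ _ _ _ (fun t => w (t * b) : k^o)); last first.
  by move=> c y z; rewrite mulrDl -scalerAl dual_linear.
apply: (@eq_tlift _ _ _ k^o) => u v.
rewrite -scalerAr mulr1 -scalerAl (scalable_linear (dual_linear x)).
by rewrite (scalable_linear (dual_linear w)) [LHS]mulrC.
Qed.

(** Invariance, read in the dual algebra: [w] spans a left ideal of dimension at
    most 1 on which the algebra acts by evaluation at 1. *)
Lemma integral_absorb (x : dual G) : x * w = x 1 *: w.
Proof.
apply: dualP => a; transitivity (x (tlift (fun y z => w z *: y) (comul G a))).
  rewrite [RHS](tlift_post _ _ (dual_linear x)).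
  apply: (@eq_tlift _ _ _ k^o) => y z.
  by rewrite [RHS](scalable_linear (dual_linear x)) mulrC.
by rewrite w_int.1 [LHS](scalable_linear (dual_linear x)) [LHS]mulrC.
Qed.

(** The mirror image of [mul_density]. It needs invariance on the other side,
    used in the form [w * y = y(1) w] for all forms [y], which follows from
    [integral_absorb] when [w] is central. *)
Lemma density_mul (x : dual G) c : (forall y, w * y = y * w) ->
  density c * x = density (tlift (fun u v => x (antipode G v) *: u) (comul G c)).
Proof.
move=> w_central; apply: dualP => b.
pose P c' : A := tlift (fun y z => w (c' * y) *: z) (comul G b).
have lP : linear P.
  move=> d y z; rewrite /P /tlift /tsum scaler_sumr -big_split /=.
  by apply: eq_bigr => p _; rewrite mulrDl -scalerAl dual_linear scalerDl -scalerA.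
have Pid (y : dual G) c' : y (conv G P id c') = w (c' * b) * y 1.
  transitivity ((w * y) (c' * b)); last first.
    by rewrite w_central integral_absorb [LHS]mulrC.
  rewrite [RHS](tlift_comulM _ _ (prod_bilinear w y)).
  rewrite [LHS](tlift_post _ _ (dual_linear y)).
  apply: (@eq_tlift _ _ _ k^o) => u v.
  rewrite /P (@tlift_post _ _ _ _ _ _ (fun t => y (t * v) : k^o)); last first.
    by move=> d s t; rewrite mulrDl -scalerAl dual_linear.
  apply: (@eq_tlift _ _ _ k^o) => s t.
  by rewrite -scalerAl (scalable_linear (dual_linear y)) [t * v]mulrC.
transitivity (x (P c)).
  rewrite /P [RHS](tlift_post _ _ (dual_linear x)).
  apply: (@eq_tlift _ _ _ k^o) => y z.
  by rewrite [RHS](scalable_linear (dual_linear x)).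
rewrite -(conv_antipodeK G lP) {1}/conv.
rewrite [LHS](tlift_post _ _ (dual_linear x)).
rewrite [RHS](@tlift_post _ _ _ _ _ _ (fun t => w (t * b) : k^o)); last first.
  by move=> d y z; rewrite mulrDl -scalerAl dual_linear.
apply: (@eq_tlift _ _ _ k^o) => u v.
have lx : linear (fun t => x (t * antipode G v) : k^o).
  by move=> d y z; rewrite mulrDl -scalerAl dual_linear.
(* Invariance is applied to the form t |-> x (t * S v), v being fixed. *)
rewrite -[LHS]/(mk_dual G lx (conv G P id u)) Pid.
rewrite [X in _ * X]/dual_fun /= mul1r -scalerAl.
by rewrite (scalable_linear (dual_linear w)) [RHS]mulrC.
Qed.

End Density.

(** * Traces in a product of finite-dimensional algebras *)

(** The trace of an endomorphism written as a sum of rank-one maps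
    [x |-> l x *: v] is the sum of the [l v]. *)
Lemma alg_trace_sum (k : fieldType) (B : falgType k) (b : B) (I : Type)
    (s : seq I) (l : I -> B -> k^o) (v : I -> B) :
  (forall i, linear (l i)) -> (forall x, b * x = \sum_(i <- s) l i x *: v i) ->
  alg_trace b = \sum_(i <- s) l i (v i).
Proof.
move=> ll bE; rewrite /alg_trace.
under eq_bigr do rewrite bE linear_sum.
rewrite exchange_big /=; apply: eq_bigr => i _.
pose li : {linear B -> k^o} := HB.pack_for {linear B -> k^o} (l i)
  (GRing.isSemilinear.Build k B k^o *:%R (l i) (GRing.semilinear_linear (ll i))).
rewrite -[RHS]/(li (v i)) [X in li X](coord_vbasis (memvf (v i))) linear_sum.
by apply: eq_bigr => j _; rewrite !linearZ /= [RHS]mulrC.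
Qed.

Section Decomposition.
Variables (k : fieldType) (A : comAlgType k) (G : affine_group A).
Variable D : simple_decomposition G.
Implicit Types (f g x : dual G) (i j : factor_index D).

Local Notation "'pr" := (factor_proj D).

Lemma factor_proj_inj f g : (forall i, 'pr i f = 'pr i g) -> f = g.
Proof.
move=> e; apply: (bij_inj (factor_proj_bij D)).
exact: functional_extensionality_dep.
Qed.

Lemma factor_lift_subproof i (b : factor i) :
  {f : dual G | 'pr i f = b /\ forall j, j != i -> 'pr j f = 0}.
Proof.
apply: cid; case: (factor_proj_bij D) => h _ hK.
exists (h (dfwith (fun j => 0) b)).
have e j : 'pr j (h (dfwith (fun j => 0) b)) = dfwith (fun j => 0) b j.
  exact: (congr1 (fun u => u j) (hK (dfwith (fun j => 0) b))).
by split=> [|j ji]; rewrite e ?dfwith_in // dfwith_out // eq_sym.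
Qed.

(** The inclusion of a factor in the product, as the [i]-th coordinate. *)
Definition factor_lift i (b : factor i) : dual G := sval (factor_lift_subproof b).

Lemma factor_liftK i : cancel (@factor_lift i) ('pr i).
Proof. by move=> b; exact: (svalP (factor_lift_subproof b)).1. Qed.

Lemma factor_lift0 i j (b : factor i) : j != i -> 'pr j (factor_lift b) = 0.
Proof. exact: (svalP (factor_lift_subproof b)).2. Qed.

Lemma factor_liftP i (b : factor i) f :
  'pr i f = b -> (forall j, j != i -> 'pr j f = 0) -> f = factor_lift b.
Proof.
move=> fi fj; apply: factor_proj_inj => j.
by have [->|ji] := eqVneq j i; rewrite ?factor_liftK // factor_lift0 // fj.
Qed.

Lemma factor_lift_linear i : linear (@factor_lift i).
Proof.
move=> c b b'; apply/esym/factor_liftP => [|j ji]; rewrite linearP /=.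
  by rewrite !factor_liftK.
by rewrite !factor_lift0 // scaler0 addr0.
Qed.

(** The central idempotent of the dual algebra that cuts out the [i]-th factor. *)
Definition factor_unit i : dual G := factor_lift (1 : factor i).

Lemma factor_unitM i f : factor_unit i * f = factor_lift ('pr i f).
Proof.
apply: factor_liftP => [|j ji]; rewrite rmorphM /= /factor_unit.
  by rewrite factor_liftK mul1r.
by rewrite factor_lift0 // mul0r.
Qed.

Lemma mul_factor_unit i f : f * factor_unit i = factor_lift ('pr i f).
Proof.
apply: factor_liftP => [|j ji]; rewrite rmorphM /= /factor_unit.
  by rewrite factor_liftK mulr1.
by rewrite factor_lift0 // mulr0.
Qed.

Lemma dual_sum_expand (r : seq (factor_index D)) f : uniq r ->
  (forall i, 'pr i f != 0 -> i \in r) -> f = \sum_(i <- r) factor_unit i * f.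
Proof.
move=> ur supp; apply: factor_proj_inj => j; rewrite linear_sum /=.
have e i : i != j -> 'pr j (factor_unit i * f) = 0.
  by move=> ij; rewrite factor_unitM factor_lift0 // eq_sym.
have [jr|jr] := boolP (j \in r).
  rewrite (bigD1_seq j) //= factor_unitM factor_liftK big1 ?addr0 //.
rewrite big1_seq; first by apply/eqP; apply: contraNT jr; apply: supp.
by move=> i /andP[_ ir]; apply: e; apply: contraNneq jr => <-.
Qed.

(** Left multiplication by [f] is a finite sum of rank-one operators that are
    given by evaluations at elements of [A]. *)
Definition finite_rank_mul f (s : seq (A * dual G)) : Prop :=
  forall x, f * x = \sum_(p <- s) (x p.1 : k) *: p.2.

Lemma sum_dualE (I : Type) (s : seq I) (F : I -> dual G) a :
  (\sum_(i <- s) F i : dual G) a = \sum_(i <- s) F i a.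
Proof. exact: (big_morph (fun f : dual G => f a)). Qed.

(** If [f] had more nonzero components than the rank bound [size s], then some
    nontrivial combination [x] of the corresponding idempotents would vanish at
    all the points [p.1]. This gives [f * x = 0], although the components of
    [f * x] are the nonzero components of [f], scaled by the coefficients
    of [x]. *)
Lemma finite_rank_dual_sum f s : finite_rank_mul f s -> dual_sum D f.
Proof.
move=> fE; rewrite /dual_sum /=; apply: contrapT.
move=> /(infinite_set_fset (size s).+1)[B Bf Bs].
pose t := in_tuple (enum_fset B); pose q := in_tuple s.
pose M := \matrix_(i < size (enum_fset B), j < size s)
  (factor_unit (tnth t i) (tnth q j).1 : k).
have : ~~ row_free M.
  by rewrite -row_leq_rank -ltnNge (leq_ltn_trans (rank_leq_col _)).
rewrite -kermx_eq0 -nz_row_eq0; set u := nz_row _ => u0.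
have uM : u *m M = 0 by apply/sub_kermxP/nz_row_sub.
pose x : dual G := \sum_i u 0 i *: factor_unit (tnth t i).
have fx : f * x = 0.
  rewrite fE big_tnth big1 // => j _.
  suff -> : x (tnth q j).1 = (u *m M) 0 j by rewrite uM mxE scale0r.
  rewrite sum_dualE mxE; apply: eq_bigr => i _.
  by rewrite mxE.
case/negP: u0; apply/eqP/rowP => i; rewrite mxE.
have := congr1 ('pr (tnth t i)) fx; rewrite rmorphM /x rmorph_sum rmorph0 /=.
rewrite (bigD1 i) //= linearZ /= factor_liftK big1 => [|j ji].
  rewrite addr0 -scalerAr mulr1 => /eqP; rewrite scaler_eq0 => /orP[/eqP //|fi].
  by have /negP[] : 'pr (tnth t i) f != 0 by apply: Bf; apply: mem_tnth.
rewrite linearZ /= factor_lift0 ?scaler0 //.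
have /tuple_uniqP tI : uniq t by apply: fset_uniq.
by rewrite (inj_eq tI) eq_sym.
Qed.

Lemma trace_factor f s i : finite_rank_mul f s ->
  alg_trace ('pr i f) = \sum_(p <- s) (factor_unit i * p.2 : dual G) p.1.
Proof.
move=> fE; rewrite (@alg_trace_sum _ _ _ _ s
  (fun p (y : factor i) => factor_lift y p.1 : k^o) (fun p => 'pr i p.2)).
- by apply: eq_bigr => p _; rewrite factor_unitM.
- by move=> p c y z; rewrite factor_lift_linear.
move=> y; rewrite -{1}(factor_liftK y) -rmorphM fE rmorph_sum.
by apply: eq_bigr => p _ /=; rewrite linearZ.
Qed.

(** On the [i]-th factor the trace is the sum of the values of the [i]-th
    components of the forms [p.2] at the points [p.1]; when these forms have
    finite support, summing over [i] puts their components together again. *)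
Lemma finite_rank_tr f s : finite_rank_mul f s ->
  (forall p, p \in s -> dual_sum D p.2) ->
  tr D f = \sum_(p <- s) p.2 p.1.
Proof.
move=> fE sD.
have [r ur rP] : exists2 r : seq (factor_index D), uniq r &
    forall p i, p \in s -> 'pr i p.2 != 0 -> i \in r.
  elim: s sD {fE} => [|p s IH] sD; first by exists [::].
  have [|r ur rP] := IH; first by move=> q qs; apply: sD; rewrite inE qs orbT.
  have /finite_seqP[t tE] : dual_sum D p.2 by apply: sD; rewrite inE eqxx.
  exists (undup (t ++ r)); first exact: undup_uniq.
  move=> q i; rewrite mem_undup mem_cat inE => /predU1P[->|qs] qi.
    have : [set` t]%classic i by rewrite -tE.
    by move=> /= ->.
  by rewrite (rP q i) ?orbT.
have trE i := trace_factor i fE.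
(* Outside r every p.2 has zero component, so the trace on that factor is 0. *)
rewrite /tr -(fsbig_widen [set` r]%classic); first last.
- move=> i [_ /= /negP ir]; rewrite trE big1_seq // => p /andP[_ ps].
  rewrite factor_unitM; have [->|pi] := eqVneq ('pr i p.2) 0.
    by rewrite -(subrr 0) (zmod_morphism_linear (@factor_lift_linear i)) subrr.
  by have := rP p i ps pi; rewrite (negPf ir).
- exact: subsetT.
rewrite -fsbig_seq //.
under eq_bigr do rewrite trE.
rewrite exchange_big /=; apply: eq_big_seq => p ps.
by rewrite [in RHS](dual_sum_expand ur (rP p ^~ ps)) sum_dualE.
Qed.

End Decomposition.

(** * Centrality of the integral and the trace form on densities *)

Section Main.
Variables (k : fieldType) (A : comAlgType k) (G : affine_group A).
Variables (D : simple_decomposition G) (w : dual G).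
Hypothesis w_int : invariant_integral w.

Local Notation "'pr" := (factor_proj D).

(** Let [u] be a nonzero component of [w], in a simple factor [B]. By
    [integral_absorb], [B] acts on the line spanned by [u] through a character
    [chi]. The annihilator of [u] is then a two-sided ideal without 1, hence 0,
    so every element of [B] is a scalar. This makes [w] a multiple of the
    central idempotent of [B]. *)
Lemma integral_central y : w * y = y * w.
Proof.
have [i u0] : exists i, 'pr i w != 0.
  apply: contrapT => /forallNP w0.
  suff w00 : w = 0 by have := w_int.2; rewrite w00 => /eqP; rewrite eq_sym oner_eq0.
  apply: (@factor_proj_inj _ _ _ D) => i; rewrite rmorph0.
  by apply/eqP; apply: contrapT => /negP /w0.
set u := 'pr i w in u0.
pose chi (b : factor i) : k := factor_lift b 1.
have uE b : b * u = chi b *: u.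
  by rewrite -{1}(factor_liftK b) -rmorphM (integral_absorb w_int) /= linearZ.
have chi1 : chi 1 = 1.
  apply/eqP; rewrite -subr_eq0; have : (chi 1 - 1) *: u == 0.
    by rewrite scalerBl -uE mul1r scale1r subrr.
  by rewrite scaler_eq0 (negPf u0) orbF.
have uS : u = chi u *: 1.
  pose J := lker (amulr u).
  have JP b : (b \in J) = (b * u == 0) by rewrite memv_ker lfunE.
  have [||J0|JT] := @factor_simple _ _ _ D i J.
  - apply/prodvP => b c _; rewrite !JP -mulrA => /eqP ->.
    by rewrite mulr0.
  - apply/prodvP => b c; rewrite !JP -mulrA => /eqP bu _.
    by rewrite uE -scalerAr bu scaler0.
  (* The element u - chi(u) lies in the annihilator of u. *)
  - apply/eqP; rewrite -subr_eq0 -memv0 -J0 JP mulrBl uE -scalerAl mul1r.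
    by rewrite subrr.
  by have := memvf (1 : factor i); rewrite -JT JP mul1r (negPf u0).
have -> : w = chi u *: factor_unit i.
  rewrite -[LHS]scale1r -chi1 -(integral_absorb w_int) factor_unitM -/u {1}uS.
  by rewrite (scalable_linear (@factor_lift_linear _ _ _ D i)).
by rewrite -scalerAl -scalerAr factor_unitM mul_factor_unit.
Qed.

Lemma density_finite_rank c : finite_rank_mul (density w c)
  [seq (antipode G p.2, density w p.1) | p <- repr (comul G c)].
Proof.
move=> x; rewrite (density_mul w_int) ?big_map; last exact: integral_central.
rewrite (tlift_post _ _ (linear_density w)); apply: eq_bigr => p _.
exact: (scalable_linear (linear_density w)).
Qed.

Lemma density_dual_sum c : dual_sum D (density w c).
Proof. exact: finite_rank_dual_sum (density_finite_rank c). Qed.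

(** The trace is the sum of the [w (c_1 S(c_2))], which is the counit of [c]
    because [w 1 = 1]. *)
Lemma tr_density c : tr D (density w c) = counit G c.
Proof.
rewrite (finite_rank_tr (density_finite_rank c)); last first.
  by move=> _ /mapP[p _ ->]; apply: density_dual_sum.
rewrite big_map.
transitivity (w (tlift (fun x y => x * antipode G y) (comul G c))).
  by rewrite (tlift_post _ _ (dual_linear w)).
by rewrite antipoder [LHS](scalable_linear (dual_linear w)) w_int.2 [LHS]mulr1.
Qed.

(** The product is again a density, by [mul_density], and its trace is the counit
    of the sum of the [w (c S(d_1)) d_2]. *)
Lemma T_down_density c d :
  T_down D (density w c) (density w d) = w (c * antipode G d).
Proof.
rewrite /T_down (mul_density w_int) tr_density.
have lc : linear (fun t => density w c (antipode G t) : k^o).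
  by move=> e x y; rewrite linearP dual_linear.
rewrite -[RHS]/((fun t => density w c (antipode G t) : k^o) d).
rewrite -[in RHS](counitr G d) [RHS](tlift_post _ _ lc).
rewrite (tlift_post _ _ (@linearP _ _ _ _ (counit G))).
apply: (@eq_tlift _ _ _ k^o) => x y.
by rewrite linearZ /= [RHS](scalable_linear lc) [LHS]mulrC.
Qed.

Lemma fourier_density a : fourier w a = density w (antipode G a).
Proof. exact: dualP. Qed.

End Main.

Unset Implicit Arguments.

Theorem mainTheorem3 (k : fieldType) (A : comAlgType k) (G : affine_group A)
    (ssG : semisimple G) (D : simple_decomposition G)
    (w : dual G) (w_int : invariant_integral w) (a b : A) :
  [/\ dual_sum D (fourier w a), dual_sum D (fourier w b),
      w (antipode G a * b) = T_up w a b,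
      T_up w a b = T_down D (fourier w a) (fourier w b) &
      T_down D (fourier w a) (fourier w b) = tr D (fourier w a * fourier w b)].
Proof.
rewrite !fourier_density; split=> //; try exact: density_dual_sum.
by rewrite T_down_density // antipodeK.
Qed.
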